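(* For every nonnegative integer $n$, $A(n) = |S_n|$.
   Context: For a positive integer $i$, let $d_1(i)$ and $d_0(i)$ denote the number of digits $1$ and the number of digits $0$, respectively, in the binary expansion of $i$ (without leading zeros). For every nonnegative integer $n$, set $A(n)=\sum_{i=1}^{n}\bigl(d_1(i)-d_0(i)\bigr)$, so that $A(0)=0$ (this is the OEIS sequence A268289). For every nonnegative integer $n$, $S_n$ is the set of integers $$S_n = \left\{ m \;\middle|\; 1\leqslant m\leqslant n,\ \left((n-m) \bmod 2^{\lfloor\log_2 m\rfloor+1}\right) < 2^{\lfloor\log_2 m\rfloor}\right\},$$ where $a \bmod b$ is the remainder in $\{0,\dots,b-1\}$ of $a$ divided by $b$, and $|S_n|$ is its cardinality. *)

(* Defs.v *)
From mathcomp Require Import all_boot all_order all_algebra.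

Set Implicit Arguments.
Unset Strict Implicit.
Unset Printing Implicit Defensive.

Import GRing.Theory.

(* Least significant digit first. [trunc_log 2 i] is the floor of log_2 i, so
   for i > 0 the last entry is the leading 1 and there are no leading zeros.
   Only used for i > 0: for i = 0 this is the single digit 0. *)
Definition binary_digits (i : nat) : bitseq :=
  [seq odd (i %/ 2 ^ k) | k <- iota 0 (trunc_log 2 i).+1].

Definition d1 (i : nat) : nat := count_mem true (binary_digits i).

Definition d0 (i : nat) : nat := count_mem false (binary_digits i).

Definition A (n : nat) : int :=
  (\sum_(1 <= i < n.+1) ((d1 i)%:Z - (d0 i)%:Z))%R.

(* Since m ranges over 'I_n.+1, m <= n and the truncated subtraction n - m is
   exact. *)
Definition S_set (n : nat) : {set 'I_n.+1} :=
  [set m : 'I_n.+1 | (1 <= m) &&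
     ((n - m) %% 2 ^ (trunc_log 2 m).+1 < 2 ^ trunc_log 2 m)].

(* Main.v *)
Require Import Defs.
From mathcomp Require Import all_boot all_order all_algebra.
From mathcomp Require Import zify.

(** Both sides split according to a bit position [k], which contributes to [A]
    through the integers [i >= 2 ^ k] and to [S_n] through the [m] with
    [2 ^ k <= m < 2 ^ k.+1].  Put [q = 2 ^ k] and let [f x] say that bit [k] of
    [x] is [0].  Adding [q] flips bit [k] and adding [2 * q] preserves it, so

    - [i >= q] has a [1] at position [k] exactly when [f (i - q)];
    - [i >= q] has a [0] at position [k] exactly when [i >= 2 * q] and
      [f (i - 2 * q)], because bit [k] of any [i] in [q, 2q) is its leading [1].

    Hence among [i <= n] the ones at position [k] are counted by the [x] in
    [0, n - q] with [f x], the zeros by the [x] in [0, n - 2q] with [f x], and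
    their difference by the [x = n - m] with [f x], where [q <= m < 2q] and
    [m <= n].  Finally [f x] amounts to [x %% (2 * q) < q], so the [m] counted
    are those in [S_n] with [trunc_log 2 m = k].  Lemma [count_bit_window] is
    this identity for one [k], stated additively (ones = zeros + window) to stay
    in [nat]; it is summed over [k] by [sum_count_binary_digits] and
    [card_S_set]. *)

Lemma odd_divnDl q x : 0 < q -> odd ((q + x) %/ q) = ~~ odd (x %/ q).
Proof. by move=> q0; rewrite divnDl ?dvdnn // divnn q0 oddD. Qed.

Lemma ltn_mod_double q x : 0 < q -> (x %% (q * 2) < q) = ~~ odd (x %/ q).
Proof.
move=> q0; have q2 : 0 < q * 2 by rewrite muln_gt0 q0.
rewrite {2}(divn_eq x (q * 2)) [q * 2]mulnC mulnA divnMDl // [2 * q]mulnC.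
rewrite oddD oddM andbF /=.
have [lt_q|ge_q] := ltnP (x %% (q * 2)) q; first by rewrite divn_small.
rewrite -(subnKC ge_q) odd_divnDl // divn_small //.
by rewrite ltn_subLR // addnn -muln2 ltn_mod.
Qed.

(** For [q <= n] both sums list [f 0, ..., f (n - q)], in opposite
    orders. *)
Lemma sum_shift_rev (f : nat -> nat) q n :
  \sum_(q <= i < n.+1) f (i - q) = \sum_(q <= m < n.+1) f (n - m).
Proof.
rewrite big_nat_rev /=; apply: eq_big_nat => i /andP[le_qi lt_in].
by congr f; lia.
Qed.

Lemma count_bit_window q n : 0 < q ->
  \sum_(q <= i < n.+1) odd (i %/ q)
  = \sum_(q <= i < n.+1) ~~ odd (i %/ q)
    + \sum_(q <= m < n.+1 | m < q * 2) ~~ odd ((n - m) %/ q).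
Proof.
move=> q0; pose f x : nat := ~~ odd (x %/ q).
have ones : \sum_(q <= i < n.+1) odd (i %/ q) = \sum_(q <= m < n.+1) f (n - m).
  rewrite -sum_shift_rev; apply: eq_big_nat => i /andP[le_qi _].
  by rewrite -{1}(subnKC le_qi) odd_divnDl.
have zeros : \sum_(q <= i < n.+1) ~~ odd (i %/ q)
           = \sum_(q * 2 <= m < n.+1) f (n - m).
  rewrite -sum_shift_rev (big_nat_widenl (q * 2) q) ?leq_pmulr //.
  rewrite [RHS]big_mkcond; apply: eq_big_nat => i /andP[le_qi _] /=.
  rewrite /f -{1}(subnKC le_qi) odd_divnDl // negbK.
  (* For [q <= i < q * 2] the bit is the leading [1]. *)
  case: leqP => [le_2qi|lt_i2q]; last by rewrite divn_small //; lia.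
  by rewrite (_ : i - q = q + (i - q * 2)) ?odd_divnDl //; lia.
rewrite ones zeros (big_nat_widenl (q * 2) q) ?leq_pmulr //.
rewrite (bigID (fun m => q * 2 <= m)) /=; congr (_ + _).
by apply: eq_bigl => m; rewrite ltnNge.
Qed.

Lemma trunc_log2_lt i : 0 < i -> trunc_log 2 i < i.
Proof.
move=> i0; have le_i : 2 ^ trunc_log 2 i <= i by exact: trunc_logP.
by apply: leq_trans le_i; apply: ltn_expl.
Qed.

(** A position [k] occurs in [i > 0] exactly when [2 ^ k <= i]; the bound [n.+1]
    on [k] serves all [i <= n] at once. *)
Lemma sum_count_binary_digits b n :
  \sum_(1 <= i < n.+1) count_mem b (binary_digits i)
  = \sum_(0 <= k < n.+1) \sum_(2 ^ k <= i < n.+1) (odd (i %/ 2 ^ k) == b).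
Proof.
transitivity (\sum_(1 <= i < n.+1) \sum_(0 <= k < n.+1 | 2 ^ k <= i)
                (odd (i %/ 2 ^ k) == b)).
  apply: eq_big_nat => i /andP[i0 lt_in].
  have lt_log : trunc_log 2 i < n.+1.
    by apply: ltn_trans lt_in; apply: trunc_log2_lt.
  rewrite /binary_digits count_map -sum1_count big_mkcond.
  rewrite -[iota 0 _]/(index_iota 0 (trunc_log 2 i).+1).
  rewrite (big_nat_widen _ _ _ _ _ lt_log).
  apply: eq_big => [k|k _] /=; last by case: eqP.
  rewrite ltnS; apply/idP/idP => [le_k|]; last exact: trunc_log_max.
  have le_i : 2 ^ trunc_log 2 i <= i by exact: trunc_logP.
  by apply: leq_trans le_i; rewrite leq_exp2l.
rewrite (exchange_big_dep xpredT) //=; apply: eq_bigr => k _.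
by rewrite [RHS](big_nat_widenl _ 1) // expn_gt0.
Qed.

(** Each [m] of [S_n] is counted only at [k = trunc_log 2 m], the one [k] with
    [2 ^ k <= m < 2 ^ k * 2]. *)
Lemma card_S_set n :
  #|S_set n| = \sum_(0 <= k < n.+1)
    \sum_(2 ^ k <= m < n.+1 | m < 2 ^ k * 2) ~~ odd ((n - m) %/ 2 ^ k).
Proof.
under [RHS]eq_bigr => k _ do rewrite (big_nat_widenl _ 1) ?expn_gt0 //.
rewrite [RHS](exchange_big_dep xpredT) //=.
transitivity (\sum_(1 <= m < n.+1) ((n - m) %% 2 ^ (trunc_log 2 m).+1
                                    < 2 ^ trunc_log 2 m)).
  (* The index [m = 0] of ['I_n.+1] is excluded by [1 <= m]. *)
  rewrite -sum1dep_card big_mkcond -(big_mkord xpredT (fun m => if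
    (1 <= m) && ((n - m) %% 2 ^ (trunc_log 2 m).+1 < 2 ^ trunc_log 2 m)
    then 1 else 0)) big_ltn //= add0n.
  by apply: eq_big_nat => m /andP[-> _] /=; case: ltnP.
apply: eq_big_nat => m /andP[m0 lt_mn].
have lt_log : trunc_log 2 m < n.+1.
  by apply: ltn_trans lt_mn; apply: trunc_log2_lt.
transitivity (\sum_(0 <= k < n.+1 | k == trunc_log 2 m)
                ~~ odd ((n - m) %/ 2 ^ k)).
  by rewrite big_nat1_eq lt_log expnSr ltn_mod_double ?expn_gt0.
apply: eq_bigl => k; rewrite -expnSr andbC.
apply/eqP/idP => [->|]; first exact: trunc_log_bounds.
by move/(trunc_log_eq (isT : 1 < 2)).
Qed.

Theorem theorem2p4 (n : nat) : A n = (#|S_set n|%:Z)%R.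
Proof.
have ones_zeros :
    \sum_(1 <= i < n.+1) d1 i = \sum_(1 <= i < n.+1) d0 i + #|S_set n|.
  rewrite /d1 /d0 !sum_count_binary_digits card_S_set -big_split.
  apply: eq_bigr => k _ /=.
  under eq_bigr do rewrite eqb_id.
  under [in RHS]eq_bigr do rewrite eqbF_neg.
  by rewrite count_bit_window // expn_gt0.
rewrite /A GRing.sumrB -!(big_morph Posz PoszD (erefl _)) ones_zeros PoszD.
by rewrite GRing.addrC GRing.addKr.
Qed.
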